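(* For every positive integer $N$, let $ht(N)$ denote the height of the lattice $\Lambda_N$ (defined in the context). Then (i) for all $N\ge 1$, $ht(N) \le \lfloor c\,(N-1)\rfloor$, where $$c=\sum_{i=0}^{\infty}\frac{1}{2^{2^i}-1}=1.4039\ldots;$$ (ii) if $N=2^{2^m}$ for some integer $m\ge 0$, then $ht(N)=\lfloor c\,(N-1)\rfloor$.
   Context: An orthogonal array $OA(N, s_1^{k_1} s_2^{k_2}\cdots s_v^{k_v})$ (of strength 2) is an $N\times k$ array, $k=k_1+\cdots+k_v$, whose first $k_1$ columns have entries from $\{0,\dots,s_1-1\}$, next $k_2$ columns entries from $\{0,\dots,s_2-1\}$, etc., such that in every $N\times 2$ subarray every possible ordered pair of symbols occurs equally often as a row. Normally $2\le s_1<s_2<\cdots$ and all $k_i\ge1$; one also allows the trivial array $OA(N,1^1)$, a single column of $N$ zeros. The symbol $(N,s_1^{k_1}s_2^{k_2}\cdots)$ is a parameter set; it is realized if such an array exists. Expansive replacement: given an $OA$ $A$ with $N$ runs and a column of $A$ with $S$ levels, and an orthogonal array $B$ with $S$ runs (of strength 2, possibly the trivial $OA(S,1^1)$), replace that column by the rows of $B$ (each occurrence of symbol $j$ is replaced by the $j$-th row of $B$); this includes deleting a factor and replacing an $s$-level factor by an $s'$-level factor when $s'\mid s$. A parameter set $P$ is dominated by a parameter set $Q$ if an array with parameter set $P$ can be obtained from an array with parameter set $Q$ by a finite sequence of expansive replacements. $\Lambda_N$ is the set of realized parameter sets with $N$ runs, partially ordered by dominance; it is a lattice with maximum $(N,N^1)$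 and minimum $(N,1^1)$. The height of a node is the number of edges in a longest downward path from it to $(N,1^1)$ in the Hasse diagram, and $ht(N)$ is the height of $(N,N^1)$. *)

(* Defs.v *)
From HB Require Import structures.
From Stdlib Require Import Relation_Operators.
From mathcomp Require Import all_boot all_order all_algebra.
From mathcomp Require Import all_classical all_reals all_analysis.

Set Implicit Arguments.
Unset Strict Implicit.
Unset Printing Implicit Defensive.

Import numFieldNormedType.Exports.

(* A column of an array with [N] rows, together with its number of levels. *)
Record factor (N : nat) := Factor {
  levels : nat;
  symbol :> 'I_N -> 'I_levels
}.

(* An array with [N] rows, given by its columns. *)
Definition array (N : nat) := seq (factor N).

Definition balanced (N : nat) (f : factor N) : bool :=
  [forall x : 'I_(levels f), forall y : 'I_(levels f),
    #|[pred r : 'I_N | f r == x]| == #|[pred r : 'I_N | f r == y]|].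

Definition orthogonal (N : nat) (f g : factor N) : bool :=
  [forall x : 'I_(levels f) * 'I_(levels g),
   forall y : 'I_(levels f) * 'I_(levels g),
    #|[pred r : 'I_N | (f r, g r) == x]| == #|[pred r : 'I_N | (f r, g r) == y]|].

(* For two or more columns [all (@balanced N) A] follows from pairwise         *)
(* orthogonality; it is only needed for one-column arrays, where a condition   *)
(* on pairs of columns is vacuous (it makes OA(N, s^1) exist only if s %| N).  *)
Definition is_OA (N : nat) (A : array N) : Prop :=
  [/\ A <> [::], all (@balanced N) A & pairwise (@orthogonal N) A].

(* A parameter set (N, s_1^{k_1} s_2^{k_2} ...) is encoded, for fixed N, by    *)
(* the nondecreasing sequence of its levels, listed with multiplicity; the     *)
(* trivial parameter set (N, 1^1) is [:: 1].                                   *)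
Definition paramset := seq nat.

(* One-level columns, which arise when a factor is replaced by the trivial     *)
(* array, count as deleted unless no other column is left.                     *)
Definition params (N : nat) (A : array N) : paramset :=
  let l := sort leq [seq s <- map (@levels N) A | 1 < s] in
  if l is [::] then [:: 1] else l.

Definition realized (N : nat) (P : paramset) : Prop :=
  exists A : array N, is_OA A /\ params A = P.

(* The factor whose entry in row [r] is the entry of [b] in row [f r]. *)
Definition factor_comp (N : nat) (f : factor N) (b : factor (levels f)) :
    factor N :=
  Factor (fun r : 'I_N => b (f r)).

Inductive expansive_replacement (N : nat) : array N -> array N -> Prop :=
  | ExpansiveReplacement (A1 : array N) (f : factor N) (A2 : array N)
      (B : array (levels f)) :
      is_OA B ->
      expansive_replacement (A1 ++ f :: A2)
                            (A1 ++ map (@factor_comp N f) B ++ A2).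

Definition dominated (N : nat) (P Q : paramset) : Prop :=
  exists A A' : array N,
    [/\ is_OA A, params A = Q,
        clos_refl_trans _ (@expansive_replacement N) A A' & params A' = P].

(* An edge of the Hasse diagram of Lambda_N from [Q] down to [P]. *)
Definition hasse_edge (N : nat) (Q P : paramset) : Prop :=
  [/\ realized N P, realized N Q, dominated N P Q, P <> Q &
      forall S : paramset, realized N S ->
        dominated N P S -> dominated N S Q -> S = P \/ S = Q].

(* [down_path N Q n]: there is a downward path with [n] edges from [Q] to      *)
(* (N, 1^1) in the Hasse diagram of Lambda_N.                                  *)
Inductive down_path (N : nat) : paramset -> nat -> Prop :=
  | down_path0 : down_path N [:: 1] 0
  | down_pathS (Q P : paramset) (n : nat) :
      hasse_edge N Q P -> down_path N P n -> down_path N Q n.+1.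

Definition is_height (N : nat) (Q : paramset) (h : nat) : Prop :=
  down_path N Q h /\ forall n : nat, down_path N Q n -> n <= h.

(* [xget] returns 0 if there is no longest path. *)
Definition height (N : nat) (Q : paramset) : nat := xget 0 (is_height N Q).

Definition ht (N : nat) : nat := height N [:: N].

Local Open Scope ring_scope.

Definition c_terms (R : realType) (i : nat) : R := (2 ^+ (2 ^ i)%N - 1)^-1.

Definition c_const (R : realType) : R :=
  limn (series (@c_terms R)).

(* Main.v *)
(** The Rao bound [sum (t_i - 1) <= s - 1] for the levels [t_i] of an array with
    [s] runs makes [s |-> C(s) (s - 1)], with [C(s)] the sum of
    [1 / (2^(2^i) - 1)] over all [i] such that [2^(2^i) <= s], a weight which
    every nontrivial expansive replacement of an [s]-level factor lowers by at
    least [1].  So a strictly descending chain from [(N, N^1)] has at most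
    [C(N) (N - 1) <= c (N - 1)] edges.  Conversely, an affine plane of order
    [q = 2^(2^m)] is an [OA(q^2, q^(q+1))]; splitting [q^2] in this way and then
    exhausting the [q + 1] new factors one after the other yields a chain of
    length [h(m+1) = 1 + (q + 1) h(m)], that is [h(m) = C(q) (q - 1)], which is
    within distance [1] of [c (q - 1)].  A chain of maximal length is
    automatically a path in the Hasse diagram. *)

From Stdlib Require Import Relation_Operators Operators_Properties.
From mathcomp Require Import all_boot all_order all_algebra finfield.
From mathcomp Require Import all_classical all_reals all_analysis.
From mathcomp Require Import zify ring lra.
Require Import Defs.

Set Implicit Arguments.
Unset Strict Implicit.
Unset Printing Implicit Defensive.

Import Order.TTheory GRing.Theory Num.Theory.
Import numFieldNormedType.Exports.

(** * Uniform maps and the Rao bound *)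

(** One notion covers both axioms: balance is uniformity of the column, orthogonality is uniformity
    of the pair map. Closure under composition then handles replacements. *)
Definition uniform (T U : finType) (F : T -> U) : Prop :=
  forall x y : U, #|[pred r | F r == x]| = #|[pred r | F r == y]|.

Lemma balancedP (N : nat) (f : factor N) : reflect (uniform f) (balanced f).
Proof.
apply: (iffP idP) => [/forallP H x y|H].
  by move/forallP: (H x) => /(_ y)/eqP.
by apply/forallP => x; apply/forallP => y; apply/eqP.
Qed.

Lemma orthogonalP (N : nat) (f g : factor N) :
  reflect (uniform (fun r => (f r, g r))) (orthogonal f g).
Proof.
apply: (iffP idP) => [/forallP H x y|H].
  by move/forallP: (H x) => /(_ y)/eqP.
by apply/forallP => x; apply/forallP => y; apply/eqP.
Qed.

Lemma uniform_sum (V : nmodType) (T U : finType) (F : T -> U) (phi : U -> V)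
    (x : U) : uniform F ->
  (\sum_r phi (F r) = (\sum_u phi u) *+ #|[pred r | F r == x]|)%R.
Proof.
move=> unF; rewrite (partition_big F predT) //= -sumrMnl.
apply: eq_bigr => u _; rewrite (unF x u) -sumr_const.
by apply: eq_big => r; rewrite ?inE // => /eqP ->.
Qed.

Lemma uniform_card (T U : finType) (F : T -> U) (x : U) :
  uniform F -> #|T| = #|U| * #|[pred r | F r == x]|.
Proof.
move=> unF.
have := uniform_sum (V := nat) (fun=> 1) x unF.
by rewrite !sumr_const -mulrnA !natn.
Qed.

(** Multiplying by the number of values avoids naming a fibre. If [U] is empty, both sides are 0. *)
Lemma uniform_sum_card (V : nmodType) (T U : finType) (F : T -> U)
    (phi : U -> V) : uniform F ->
  ((\sum_r phi (F r)) *+ #|U| = (\sum_u phi u) *+ #|T|)%R.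
Proof.
move=> unF; case: (pickP (@predT U)) => [x _|U0].
  by rewrite (uniform_sum phi x unF) (uniform_card x unF) -mulrnA mulnC.
by rewrite (eq_card0 U0) mulr0n big1 ?mul0rn // => u; have := U0 u.
Qed.

(** The fibre of [G \o F] over z is a disjoint union of fibres of [F], one for each point of the
    fibre of [G] over z. *)
Lemma uniform_comp (T U V : finType) (F : T -> U) (G : U -> V) :
  uniform F -> uniform G -> uniform (G \o F).
Proof.
move=> unF unG x y.
case: (pickP (@predT U)) => [u _|U0]; last first.
  by apply/eq_card => r; have := U0 (F r).
have H z : #|[pred r | (G \o F) r == z]| =
    #|[pred v | G v == z]| * #|[pred r | F r == u]|.
  have := uniform_sum (V := nat) (fun v => (G v == z) : nat) u unF.
  rewrite -[(_ *+ _)%R]mulr_natr natn -!sum1_card => E.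
  rewrite [LHS]big_mkcond [X in _ = X * _]big_mkcond /=.
  etransitivity; first by etransitivity; last exact: E; apply: eq_bigr.
  by congr (_ * _)%N; apply: eq_bigr.
by rewrite !H (unG x y).
Qed.

Lemma uniform_bij (T U : finType) (F : T -> U) : bijective F -> uniform F.
Proof.
move=> [G FK GK] x y.
suff H z : #|[pred r | F r == z]| = 1 by rewrite !H.
by rewrite -(card1 (G z)); apply: eq_card => r; rewrite !inE (can2_eq FK GK).
Qed.

Lemma uniform_pair_map (T U V : finType) (F : T -> U) :
  uniform F -> uniform (fun p : T * V => (F p.1, p.2)).
Proof.
move=> unF [x v] [y w].
have H z u : #|[pred p : T * V | (F p.1, p.2) == (z, u)]| = #|[pred r | F r == z]|.
  have inj : injective (fun r : T => (r, u)) by move=> a b [].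
  rewrite -(fintype.card_image inj); apply: eq_card => -[a b]; rewrite !inE xpair_eqE /=.
  apply/andP/fintype.imageP => [[/eqP Fa /eqP ->]|[r]]; first by exists a; rewrite ?inE ?Fa.
  by rewrite inE => Fr [-> ->].
by rewrite !H (unF x y).
Qed.

(** * Expansive replacement preserves orthogonal arrays *)

Lemma orthogonal_sym (N : nat) (f g : factor N) :
  orthogonal f g -> orthogonal g f.
Proof.
move=> /orthogonalP fg; apply/orthogonalP.
apply: (uniform_comp (G := fun p => (p.2, p.1)) fg).
by apply: uniform_bij; exists (fun p => (p.2, p.1)) => -[].
Qed.

Lemma factor_comp_balanced (N : nat) (f : factor N) (b : factor (levels f)) :
  balanced f -> balanced b -> balanced (factor_comp b).
Proof. by move=> /balancedP uf /balancedP ub; apply/balancedP/(uniform_comp uf). Qed.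

Lemma factor_comp_orthogonal2 (N : nat) (f : factor N)
    (b b' : factor (levels f)) :
  balanced f -> orthogonal b b' ->
  orthogonal (factor_comp b) (factor_comp b').
Proof.
move=> /balancedP uf /orthogonalP ub; apply/orthogonalP.
exact: (uniform_comp uf ub).
Qed.

Lemma factor_comp_orthogonal (N : nat) (f g : factor N)
    (b : factor (levels f)) :
  orthogonal f g -> balanced b -> orthogonal (factor_comp b) g.
Proof.
move=> /orthogonalP ufg /balancedP ub; apply/orthogonalP.
exact: (uniform_comp ufg (uniform_pair_map (V := 'I_(levels g)) ub)).
Qed.

Lemma expansive_replacement_OA (N : nat) (A A' : array N) :
  is_OA A -> expansive_replacement A A' -> is_OA A'.
Proof.
move=> OA E; case: E OA => A1 f A2 B [B0 Bb Bo] [_ Ab Ao].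
move: Ab Ao; rewrite all_cat /= => /and3P[A1b fb A2b].
rewrite pairwise_cat allrel_consr /= => /and4P[/andP[A1f A12] A1o fA2 A2o].
have all_comp (p : pred (factor N)) (q : pred (factor (levels f))) :
    (forall b, q b -> p (factor_comp b)) -> all q B ->
    all p (map (@factor_comp N f) B).
  by move=> qp; rewrite all_map; apply: sub_all => b; exact: qp.
split.
- by case: A1 {A1b A1f A12 A1o} => //; case: B B0 {Bb Bo all_comp}.
(* The pairs that involve a new column: columns before the replaced one with new ones, new ones with
   later columns, new ones among themselves. *)
- rewrite !all_cat A1b A2b andbT /=.
  by apply: all_comp Bb => b; apply: factor_comp_balanced.
- rewrite pairwise_cat allrel_catr A12 A1o pairwise_cat A2o !andbT /=.
  apply/and3P; split.
  + apply: sub_all A1f => g gf; apply: all_comp Bb => b bb.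
    exact/orthogonal_sym/(factor_comp_orthogonal (orthogonal_sym gf)).
  + apply: all_comp Bb => b bb; apply: sub_all fA2 => g fg.
    exact: factor_comp_orthogonal.
  + rewrite pairwise_map; apply: sub_pairwise Bo => b b'.
    exact: factor_comp_orthogonal2.
Qed.

(** * The Rao bound by contrast vectors *)

Section Rao.
Local Open Scope ring_scope.
Variables (N : nat) (r0 : 'I_N).

(** For a balanced column this is the centred indicator of the rows that agree with row [r0], scaled
    to be integral. Its value at [r0] is [levels f - 1], the summand of the Rao bound. *)
Definition contrast (f : factor N) (r : 'I_N) : int :=
  (levels f)%:Z * (f r == f r0)%:Z - 1.

Lemma levels_gt0 (f : factor N) : (0 < levels f)%N.
Proof. exact: leq_ltn_trans (leq0n _) (ltn_ord (f r0)). Qed.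

Lemma contrast_level_sum (t : nat) (x : 'I_t) :
  \sum_(u < t) (t%:Z * (u == x)%:Z - 1) = 0.
Proof.
rewrite sumrB -mulr_sumr (bigD1 x) //= eqxx big1 => [|i /negbTE -> //].
by rewrite sumr_const card_ord; lia.
Qed.

Lemma contrast_level_sqr_sum (t : nat) (x : 'I_t) :
  \sum_(u < t) (t%:Z * (u == x)%:Z - 1) ^+ 2 = t%:Z * (t%:Z - 1).
Proof.
(* The contrast takes only the values t - 1 and -1, the roots of X^2 - (t - 2) X - (t - 1). *)
have E (u : 'I_t) : (t%:Z * (u == x)%:Z - 1) ^+ 2 =
    (t%:Z - 2) * (t%:Z * (u == x)%:Z - 1) + (t%:Z - 1).
  by case: (u == x) => /=; rewrite ?mulr1 ?mulr0; ring.
under eq_bigr do rewrite E.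
rewrite big_split -mulr_sumr contrast_level_sum sumr_const card_ord /=.
by rewrite mulr0 add0r -mulr_natl natz.
Qed.

Lemma sum_contrast (f : factor N) : balanced f -> \sum_r contrast f r = 0.
Proof.
move=> /balancedP uf.
have := uniform_sum_card (fun u => (levels f)%:Z * (u == f r0)%:Z - 1) uf.
rewrite contrast_level_sum mul0rn card_ord => /eqP.
by rewrite mulrn_eq0 gtn_eqF ?levels_gt0 //= => /eqP.
Qed.

Lemma sum_contrast_sqr (f : factor N) : balanced f ->
  \sum_r contrast f r ^+ 2 = N%:Z * ((levels f)%:Z - 1).
Proof.
move=> /balancedP uf.
have := uniform_sum_card (fun u => ((levels f)%:Z * (u == f r0)%:Z - 1) ^+ 2) uf.
rewrite contrast_level_sqr_sum !card_ord => E.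
have t0 : (levels f)%:R != 0 :> int by rewrite pnatr_eq0 gtn_eqF ?levels_gt0.
apply: (mulIf t0); rewrite mulr_natr [LHS]E -mulr_natl !natz.
by ring.
Qed.

(** By orthogonality the sum over rows is proportional to the sum over all pairs of levels, whose
    inner sum vanishes. *)
Lemma sum_contrastM (f g : factor N) : orthogonal f g ->
  \sum_r contrast f r * contrast g r = 0.
Proof.
move=> /orthogonalP ufg.
have := uniform_sum_card (fun p =>
  ((levels f)%:Z * (p.1 == f r0)%:Z - 1) * ((levels g)%:Z * (p.2 == g r0)%:Z - 1)) ufg.
rewrite -(pair_bigA _ (fun u v => ((levels f)%:Z * (u == f r0)%:Z - 1) *
  ((levels g)%:Z * (v == g r0)%:Z - 1))) /=.
rewrite [X in _ = X *+ _]big1 => [|u _]; last first.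
  by rewrite -mulr_sumr contrast_level_sum mulr0.
rewrite mul0rn card_prod !card_ord => /eqP.
by rewrite mulrn_eq0 muln_eq0 !gtn_eqF ?levels_gt0 //= => /eqP.
Qed.

(* Over all rows r, the vector v(r) = 1 + sum of the contrasts has square norm
   N K, where K = v(r0); hence K^2 <= N K. *)
Lemma rao_int (A : array N) : all (@balanced N) A -> pairwise (@orthogonal N) A ->
  1 + \sum_(f <- A) ((levels f)%:Z - 1) <= N%:Z.
Proof.
move=> Ab Ao; set K := (X in X <= _).
pose v r := 1 + \sum_(f <- A) contrast f r.
have vr0 : v r0 = K.
  by congr (1 + _); apply: eq_bigr => f _; rewrite /contrast eqxx mulr1.
have vK : \sum_r v r ^+ 2 = N%:Z * K.
  rewrite /v /K {v vr0 K}; elim: A Ab Ao => [|f A IH] /=.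
    move=> _ _; rewrite !big_nil addr0 mulr1.
    under eq_bigr do rewrite big_nil addr0 expr1n.
    by rewrite sumr_const card_ord natz.
  move=> /andP[fb Ab] /andP[fA Ao].
  have {IH} := IH Ab Ao; rewrite big_cons.
  set S := \sum_(g <- A) _ => IH.
  (* A new column adds its square norm; its cross terms with 1 and with the other contrasts sum to
     0. *)
  under eq_bigr => r _.
    rewrite big_cons (_ : _ ^+ 2 = (1 + \sum_(g <- A) contrast g r) ^+ 2 +
      contrast f r ^+ 2 + 2 * (contrast f r + \sum_(g <- A) contrast f r * contrast g r)).
      over.
    by rewrite -mulr_sumr; ring.
  rewrite !big_split /= IH sum_contrast_sqr // -mulr_sumr big_split /= sum_contrast //.
  have -> : \sum_r \sum_(g <- A) contrast f r * contrast g r = 0.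
    rewrite exchange_big /=; elim: A fA {Ab Ao S IH} => [|g A IH] /=.
      by rewrite big_nil.
    by move=> /andP[fg fA]; rewrite big_cons sum_contrastM // IH.
  by ring.
have K0 : 0 < K.
  rewrite ltr_wpDr // sumr_ge0 // => f _; have := levels_gt0 f; lia.
have : K ^+ 2 <= N%:Z * K.
  rewrite -vK -vr0 (bigD1 r0) //= lerDl sumr_ge0 // => r _; exact: sqr_ge0.
by rewrite expr2 ler_pM2r.
Qed.
End Rao.

(** * Level lists of orthogonal arrays *)

(** Unlike in [params], the levels are unsorted and ones are kept, so that a replacement is a splice
    of lists. *)
Definition oa_levels (N : nat) (l : seq nat) : Prop :=
  exists A : array N, is_OA A /\ map (@levels N) A = l.

Lemma oa_levels_rao (N : nat) (l : seq nat) :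
  0 < N -> oa_levels N l -> \sum_(t <- l) t.-1 < N.
Proof.
move=> N0 [A [[_ Ab Ao] <-]]; rewrite big_map.
have := rao_int (Ordinal N0) Ab Ao.
suff -> : (\sum_(f <- A) ((levels f)%:Z - 1) = (\sum_(f <- A) (levels f).-1)%N%:Z)%R.
  by lia.
elim: A {Ab Ao} => [|f A IH]; first by rewrite !big_nil.
by rewrite !big_cons IH; have := levels_gt0 (Ordinal N0) f; lia.
Qed.

Lemma oa_levels_dvd (N : nat) (l : seq nat) :
  0 < N -> oa_levels N l -> all (dvdn^~ N) l.
Proof.
move=> N0 [A [[_ Ab _] <-]]; rewrite all_map; apply: sub_all Ab => f /balancedP uf /=.
have := uniform_card (f (Ordinal N0)) uf.
by rewrite !card_ord => E; rewrite [X in _ %| X]E dvdn_mulr.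
Qed.

(** The N rows are spread evenly over the t * u pairs of symbols of two columns. *)
Lemma oa_levels_dvdM (N : nat) (l1 : seq nat) (t : nat) (l2 : seq nat) :
  0 < N -> oa_levels N (l1 ++ t :: l2) -> all (fun u => t * u %| N) (l1 ++ l2).
Proof.
move=> N0 [A [[_ _ Ao] El]].
have : pairwise (fun a b => a * b %| N) (map (@levels N) A).
  rewrite pairwise_map; apply: sub_pairwise Ao => f g /orthogonalP ufg /=.
  have := uniform_card (f (Ordinal N0), g (Ordinal N0)) ufg.
  by rewrite card_prod !card_ord => E; rewrite [X in _ %| X]E dvdn_mulr.
rewrite El pairwise_cat allrel_consr /= all_cat => /and4P[/andP[H _] _ -> _].
by rewrite andbT; apply: sub_all H => u; rewrite mulnC.
Qed.

Definition id_factor (N : nat) : factor N := Factor (fun r : 'I_N => r).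

Definition zero_factor (N : nat) : factor N := Factor (fun _ : 'I_N => ord0 : 'I_1).

Lemma oa_levels_full (N : nat) : oa_levels N [:: N].
Proof.
exists [:: id_factor N]; split=> //; split=> //=; rewrite andbT.
by apply/balancedP/uniform_bij; exists id.
Qed.

Lemma oa_levels_trivial (N : nat) : oa_levels N [:: 1].
Proof.
exists [:: zero_factor N]; split=> //; split=> //=; rewrite andbT.
by apply/balancedP => x y; rewrite !ord1.
Qed.

(** * Replacement steps on level lists *)

Inductive level_step : seq nat -> seq nat -> Prop :=
  | LevelStep (l1 : seq nat) (s : nat) (l2 t : seq nat) :
      0 < s -> oa_levels s t -> level_step (l1 ++ s :: l2) (l1 ++ t ++ l2).

Lemma expansive_level_step (N : nat) (A A' : array N) : 0 < N ->
  expansive_replacement A A' ->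
  level_step (map (@levels N) A) (map (@levels N) A').
Proof.
move=> N0 [A1 f A2 B OAB]; rewrite !map_cat /=; apply: LevelStep.
  exact: levels_gt0 (Ordinal N0) f.
by exists B; split; rewrite // -map_comp.
Qed.

Lemma level_step_expansive (N : nat) (A : array N) (l' : seq nat) :
  level_step (map (@levels N) A) l' ->
  exists2 A', expansive_replacement A A' & map (@levels N) A' = l'.
Proof.
move El: (map _ A) => l E; case: E El => l1 s l2 t _ [B [OAB Et]] El.
have : exists A1 f A2, [/\ A = A1 ++ f :: A2, map (@levels N) A1 = l1,
    levels f = s & map (@levels N) A2 = l2].
  elim: l1 A El => [|a l1 IH] [|f A] //= [<- E].
    by exists [::], f, A.
  by have [A1 [g [A2 [-> <- <- <-]]]] := IH A E; exists (f :: A1), g, A2.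
(* Once s is identified with [levels f], the array [B] has the type required to replace [f]. *)
move=> [A1 [f [A2 [-> <- Es <-]]]]; rewrite -{}Et; clear El; subst s.
eexists; first exact: ExpansiveReplacement OAB.
by rewrite !map_cat -map_comp.
Qed.

Lemma oa_levels_step (N : nat) (l l' : seq nat) :
  oa_levels N l -> level_step l l' -> oa_levels N l'.
Proof.
move=> [A [OA <-]] /level_step_expansive[A' AA' <-].
by exists A'; split=> //; exact: expansive_replacement_OA AA'.
Qed.

(** By conversion, [params A] is [normal_levels (map (@levels N) A)]. *)
Definition normal_levels (l : seq nat) : paramset :=
  let k := sort leq [seq s <- l | 1 < s] in if k is [::] then [:: 1] else k.

(** The placeholder [[:: 1]] never collides with a genuine sorted list, whose entries all exceed
    1. *)
Lemma normal_levelsP (l l' : seq nat) :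
  normal_levels l = normal_levels l' <->
  perm_eq [seq s <- l | 1 < s] [seq s <- l' | 1 < s].
Proof.
have sE k : sort leq k = [::] -> k = [::].
  by move=> E; apply/nilP; rewrite /nilp -(size_sort leq) E.
have s1 k : sort leq [seq s <- k | 1 < s] <> [:: 1].
  by move=> E; have := mem_sort leq [seq s <- k | 1 < s] 1; rewrite E mem_filter inE.
rewrite /normal_levels; split=> [|/(perm_sortP leq_total leq_trans anti_leq) -> //].
move=> H; apply/(perm_sortP leq_total leq_trans anti_leq); move: H.
case E: (sort _ _) => [|a k]; case E': (sort _ _) => [|a' k'] //.
  by move=> H; have := s1 l'; rewrite E' -H.
by move=> H; have := s1 l; rewrite E H.
Qed.

(** Every level step lifts to arrays, so dominance can be studied on level lists alone. *)
Lemma dominatedP (N : nat) (P Q : paramset) : 0 < N ->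
  dominated N P Q <-> exists l l', [/\ oa_levels N l, normal_levels l = Q,
    clos_refl_trans _ level_step l l' & normal_levels l' = P].
Proof.
move=> N0; split=> [[A [A' [OA <- AA' <-]]]|[l [l' [[A [OA <-]] <- ll' <-]]]].
  exists (map (@levels N) A), (map (@levels N) A'); split=> //; first by exists A.
  elim: AA' => [B B' BB'|B|B1 B2 B3 _ H12 _ H23] {OA}.
  - exact/rt_step/expansive_level_step.
  - exact: rt_refl.
  - exact: rt_trans H12 H23.
suff [A' AA' <-] : exists2 A', clos_refl_trans _ (@expansive_replacement N) A A' &
    map (@levels N) A' = l' by exists A, A'.
move El: (map _ A) ll' => k /clos_rt_rt1n_iff kl'.
elim: kl' A El {OA l} => {k l'} [k|k k1 l' st _ IH] A El.
  by exists A => //; exact: rt_refl.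
move: st; rewrite -El => /level_step_expansive[A1 AA1 /IH[A' A1A' <-]].
by exists A' => //; apply: rt_trans A1A'; exact: rt_step.
Qed.

Lemma oa_levels1 (l : seq nat) : oa_levels 1 l -> [seq s <- l | 1 < s] = [::].
Proof.
move=> /(oa_levels_dvd (ltnSn 0)) H; apply/eqP; rewrite -[_ == _]negbK -has_filter.
by apply/hasPn => x /(allP H); rewrite dvdn1 => /eqP ->.
Qed.

(** * The weight *)

Section Weight.
Local Open Scope ring_scope.
Variable R : realType.
Local Notation c_terms := (@c_terms R).

(** The number of i with 2^(2^i) <= s, hence the number of terms of C(s): the nested logarithm is
    the largest such i. *)
Definition loglog (s : nat) : nat :=
  if (s < 2)%N then 0%N else (trunc_log 2 (trunc_log 2 s)).+1.

Lemma leq_loglog (i s : nat) : (2 ^ (2 ^ i) <= s)%N = (i < loglog s)%N.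
Proof.
rewrite /loglog; case: (ltnP s 2) => s2.
  by rewrite ltn0; apply/negbTE; rewrite -ltnNge (leq_trans s2) // -[2%N]expn1 leq_exp2l ?expn_gt0.
have l0 : (0 < trunc_log 2 s)%N by apply: trunc_log_max.
rewrite ltnS; apply/idP/idP => H.
  by do 2 apply: trunc_log_max => //.
apply: leq_trans (trunc_logP (p := 2) _ _) => //; last by lia.
by rewrite leq_exp2l //; apply: leq_trans (trunc_logP (p := 2) _ l0) => //; rewrite leq_exp2l.
Qed.

Lemma c_terms_gt0 (i : nat) : 0 < c_terms i.
Proof.
by rewrite /Defs.c_terms invr_gt0 subr_gt0 exprn_egt1 ?ltr1n // expn_eq0.
Qed.

Lemma c_series_mono (i j : nat) : (i <= j)%N -> series c_terms i <= series c_terms j.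
Proof.
move=> ij; rewrite /series /= (big_cat_nat _ ij) //= lerDl.
by apply: sumr_ge0 => k _; exact/ltW/c_terms_gt0.
Qed.

Lemma c_series_ge0 (i : nat) : 0 <= series c_terms i.
Proof. by apply: sumr_ge0 => k _; exact/ltW/c_terms_gt0. Qed.

Definition weight (s : nat) : R := series c_terms (loglog s) * s.-1%:R.

Definition total_weight (l : seq nat) : R := \sum_(s <- l) weight s.

Lemma total_weight_cat (l l' : seq nat) :
  total_weight (l ++ l') = total_weight l + total_weight l'.
Proof. exact: big_cat. Qed.

Lemma total_weight_filter (l : seq nat) :
  total_weight [seq s <- l | (1 < s)%N] = total_weight l.
Proof.
rewrite /total_weight big_filter big_mkcond; apply: eq_bigr => -[|[|s]] _ //=.
  by rewrite /weight mulr0.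
by rewrite /weight mulr0.
Qed.

(** Levels at most 1 weigh nothing, including the placeholder, so the weight is a function of the
    parameter set. *)
Lemma total_weight_normal (l : seq nat) :
  total_weight (normal_levels l) = total_weight l.
Proof.
rewrite -[RHS]total_weight_filter /normal_levels.
have <- : total_weight (sort leq [seq s <- l | (1 < s)%N]) =
    total_weight [seq s <- l | (1 < s)%N] by apply: perm_big; rewrite perm_sort.
by case: (sort _ _) => //; rewrite /total_weight big_nil big_seq1 /weight mulr0.
Qed.

Lemma total_weight_small (m : nat) (l : seq nat) :
  all (fun t => t < 2 ^ (2 ^ m))%N l ->
  total_weight l <= series c_terms m * (\sum_(t <- l) t.-1)%N%:R.
Proof.
elim: l => [|t l IH] /=; first by rewrite /total_weight !big_nil mulr0.
move=> /andP[tm /IH {}IH]; rewrite /total_weight !big_cons natrD mulrDr.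
apply: lerD => //; apply: ler_wpM2r => //; apply: c_series_mono.
by rewrite leqNgt -leq_loglog -ltnNge.
Qed.

(* With q = 2^(2^m) <= s < q^2, either every level is below q, and then the
   summand 1/(q-1) of the coefficient is lost, or exactly one level t >= q
   occurs, t <= s/2, and 1/(q-1) is lost on the remaining s - t >= q. *)
Lemma oa_levels_weight (s : nat) (l : seq nat) : (1 < s)%N -> oa_levels s l ->
  [seq t <- l | (1 < t)%N] = [:: s] \/ total_weight l + 1 <= weight s.
Proof.
move=> s1 oal; have s0 : (0 < s)%N by lia.
have [m Em] : exists m, loglog s = m.+1.
  by rewrite /loglog ltnNge s1; eexists.
pose q := (2 ^ (2 ^ m))%N.
have qs : (q <= s)%N by rewrite leq_loglog Em.
have sq' : (s < 2 ^ (2 ^ m.+1))%N by rewrite ltnNge leq_loglog Em ltnn.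
have sq : (s < q * q)%N by rewrite -expnD addnn -mul2n -expnS.
have q1 : (1 < q)%N by rewrite -[1%N](expn0 2) ltn_exp2l // expn_gt0.
(* The last term of the coefficient contributes exactly 1 on q - 1. *)
have dq : c_terms m * (q%:R - 1) = 1.
  by rewrite /Defs.c_terms natrX mulVf // subr_eq0 -natrX -[1]/(1%:R) eqr_nat gtn_eqF.
have rao := oa_levels_rao s0 oal.
have wsE : weight s = (series c_terms m + c_terms m) * (s%:R - 1).
  by rewrite /weight Em /series /= big_nat_recr //= -subn1 natrB.
have S0 := c_series_ge0 m; have d0 := c_terms_gt0 m.
have qsR : q%:R <= s%:R :> R by rewrite ler_nat.
case: (boolP (all (fun t => t < q)%N l)) => [small|].
  right; have := total_weight_small small; rewrite wsE.
  have : (\sum_(t <- l) t.-1)%N%:R <= s%:R - 1 :> R.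
    by rewrite lerBrDr natr1 ler_nat.
  move: (_%:R : R) (total_weight l) => T W Ts WT.
  have : series c_terms m * T <= series c_terms m * (s%:R - 1) by apply: ler_wpM2l.
  have : c_terms m * (q%:R - 1) <= c_terms m * (s%:R - 1).
    by apply: ler_wpM2l; [exact: ltW | lra].
  by lra.
rewrite -has_predC => /hasP[t tl /=]; rewrite -leqNgt => qt.
move: rao oal; case/splitPr: tl => l1 l2 rao oal.
have lM := oa_levels_dvdM s0 oal.
have /allP/(_ t) := oa_levels_dvd s0 oal.
rewrite mem_cat inE eqxx orbT => /(_ isT) ts.
(* If t = s, then s * u divides s for every other level u, so the others are at most 1. *)
have [Ets|nts] := eqVneq t s.
  left; rewrite Ets filter_cat /= s1.
  have H k : {subset k <= l1 ++ l2} -> [seq u <- k | (1 < u)%N] = [::].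
    move=> kl; apply/eqP; rewrite -[_ == _]negbK -has_filter; apply/hasPn => u /kl.
    move=> /(allP lM); rewrite Ets => /(dvdn_leq s0).
    by rewrite -{2}[s]muln1 leq_pmul2l // -leqNgt.
  by rewrite !H // => u; rewrite mem_cat => ->; rewrite ?orbT.
right.
have t2s : (2 * t <= s)%N.
  move: ts => /dvdnP[[|[|k]] Es]; [by lia| |by rewrite Es leq_mul2r orbT].
  by rewrite Es mul1n eqxx in nts.
(* A second level u >= q would give q * q <= t * u <= s. *)
have small : all (fun u => u < q)%N (l1 ++ l2).
  apply: sub_all lM => u /(dvdn_leq s0) H; rewrite ltnNge; apply/negP => qu.
  have := leq_mul qt qu; lia.
have Ew : total_weight (l1 ++ t :: l2) = weight t + total_weight (l1 ++ l2).
  by rewrite !total_weight_cat {2}/total_weight big_cons addrCA.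
have := total_weight_small small; rewrite {}Ew.
move: rao; rewrite big_cat big_cons /= addnCA -big_cat /=.
set T := (\sum_(u <- l1 ++ l2) _)%N => rao.
have : weight t <= (series c_terms m + c_terms m) * (t%:R - 1).
  have -> : series c_terms m + c_terms m = series c_terms m.+1.
    by rewrite /series /= big_nat_recr.
  rewrite -[t in X in _ <= X]prednK ?(leq_trans _ qt) //; last by lia.
  rewrite -natr1 addrK /weight ler_wpM2r //; apply: c_series_mono.
  rewrite leqNgt -leq_loglog -ltnNge; apply: leq_ltn_trans sq'; lia.
have : T%:R + (t%:R - 1) <= s%:R - 1 :> R.
  rewrite addrA lerBlDr subrK -natrD ler_nat; lia.
have : q%:R <= t%:R :> R by rewrite ler_nat.
have : 2 * t%:R <= s%:R :> R by rewrite -natrM ler_nat.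
rewrite wsE; move: (T%:R : R) (t%:R : R) (weight t) => U a w.
move=> a2s qa Uas wa WU.
have : series c_terms m * (U + (a - 1)) <= series c_terms m * (s%:R - 1).
  exact: ler_wpM2l.
have : c_terms m * (q%:R - 1) <= c_terms m * (s%:R - a).
  by apply: ler_wpM2l; [exact: ltW | lra].
by lra.
Qed.

End Weight.

(** * Chains in the dominance order *)

(** As [down_path], but with strict dominance instead of covering, which is easier to establish step
    by step. *)
Inductive chain (N : nat) : paramset -> nat -> Prop :=
  | chain0 : chain N [:: 1] 0
  | chainS (Q P : paramset) (n : nat) :
      realized N Q -> dominated N P Q -> P <> Q -> chain N P n ->
      chain N Q n.+1.

Lemma realized_trivial (N : nat) : realized N [:: 1].
Proof.
have [A [OA E]] := oa_levels_trivial N.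
by exists A; split=> //; rewrite /params E.
Qed.

Lemma chain_realized (N : nat) (Q : paramset) (n : nat) :
  chain N Q n -> realized N Q.
Proof. by case=> //; exact: realized_trivial. Qed.

Lemma down_path_chain (N : nat) (Q : paramset) (n : nat) :
  down_path N Q n -> chain N Q n.
Proof.
elim=> [|{}Q P {}n [rP rQ PQ nPQ _] _ IH]; first exact: chain0.
exact: chainS PQ nPQ IH.
Qed.

Lemma max_chain_down_path (N : nat) (Q : paramset) (n : nat) :
  chain N Q n -> (forall k, chain N Q k -> k <= n) -> down_path N Q n.
Proof.
elim=> [|{}Q P {}n rQ PQ nPQ cP IH] max; first exact: down_path0.
have rP := chain_realized cP.
apply: (@down_pathS _ _ P); last first.
  (* A longer chain from [P] would extend to a longer one from [Q]. *)
  by apply: IH => k ck; have := max _ (chainS rQ PQ nPQ ck).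
(* A parameter set strictly between [P] and [Q] could be inserted into the chain. *)
split=> // S rS PS SQ; apply: contrapT => /not_orP[SP nSQ].
have := max _ (chainS rQ SQ nSQ (chainS rS PS (nesym SP) cP)).
by rewrite ltnn.
Qed.

Section Weight.
Local Open Scope ring_scope.
Variable R : realType.
Local Notation W := (@total_weight R).

Lemma level_step_weight (l l' : seq nat) : level_step l l' ->
  normal_levels l' = normal_levels l \/ W l' + 1 <= W l.
Proof.
case=> l1 s l2 t s0 oat; have [s1|s1] := ltnP 1 s; last first.
  left; have Es : s = 1%N by lia.
  move: oat; rewrite Es => /oa_levels1 Et.
  by apply/normal_levelsP; rewrite !filter_cat Et.
have [Et|wt] := oa_levels_weight R s1 oat.
  by left; apply/normal_levelsP; rewrite !filter_cat Et /= s1.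
right; rewrite !total_weight_cat [W (s :: _)]big_cons -/(W _); lra.
Qed.

(** Steps that keep the parameter set keep the weight, so they can be merged with the steps that
    lower it. *)
Lemma level_steps_weight (l l' : seq nat) : clos_refl_trans _ level_step l l' ->
  normal_levels l' = normal_levels l \/ W l' + 1 <= W l.
Proof.
elim=> [k k'|k|k1 k2 k3 _ H12 _ H23]; [exact: level_step_weight|by left|].
have W_normal k k' : normal_levels k = normal_levels k' -> W k = W k'.
  by move=> E; rewrite -total_weight_normal E total_weight_normal.
case: H12 => [E12|H12]; case: H23 => [E23|H23].
- by left; rewrite E23.
- by right; rewrite -(W_normal _ _ E12).
- by right; rewrite (W_normal _ _ E23).
- by right; lra.
Qed.

Lemma dominated_weight (N : nat) (P Q : paramset) : (0 < N)%N ->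
  dominated N P Q -> P <> Q -> W P + 1 <= W Q.
Proof.
move=> N0 /(dominatedP _ _ N0)[l [l' [_ <- ll' <-]]] nPQ.
by rewrite !total_weight_normal; have [] := level_steps_weight ll'.
Qed.

Lemma chain_weight (N : nat) (Q : paramset) (n : nat) : (0 < N)%N ->
  chain N Q n -> n%:R <= W Q.
Proof.
move=> N0; elim=> [|{}Q P {}n _ PQ nPQ _ IH].
  by rewrite /total_weight big_seq1 /weight mulr0.
by rewrite -natr1 (le_trans _ (dominated_weight N0 PQ nPQ)) // lerD2r.
Qed.

(** * The constant *)

Lemma c_terms_half (n : nat) : 2 * c_terms R n.+1 <= c_terms R n.
Proof.
rewrite /c_terms expnS mulnC exprM; set x := 2 ^+ (2 ^ n)%N.
have x2 : 2 <= x :> R.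
  by rewrite /x -[leLHS]expr1 ler_weXn2l ?ler1n // expn_gt0.
rewrite -(ler_pM2r (_ : 0 < x ^+ 2 - 1)); last by nra.
rewrite mulfVK ?lt0r_neq0 //; last by nra.
have -> : x ^+ 2 - 1 = (x - 1) * (x + 1) by ring.
by rewrite mulKf ?lt0r_neq0; lra.
Qed.

(** Since each term is at least twice the next, the k-th partial sum plus twice the k-th term is
    nonincreasing in k. *)
Lemma c_series_tail (n k : nat) :
  series (c_terms R) k <= series (c_terms R) n + 2 * c_terms R n.
Proof.
have c0 := @c_terms_gt0 R.
have [kn|/ltnW nk] := leqP k n.
  by have := c_series_mono R kn; have := c0 n; lra.
suff : series (c_terms R) k + 2 * c_terms R k <=
    series (c_terms R) n + 2 * c_terms R n by have := c0 k; lra.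
rewrite -(subnK nk) addnC; elim: (k - n)%N => [|i IH]; first by rewrite addn0.
apply: le_trans IH; rewrite addnS {1}/series /= big_nat_recr //=.
by have := c_terms_half (n + i); rewrite /series /=; lra.
Qed.

Lemma c_series_cvg : cvgn (series (c_terms R)).
Proof.
apply: nondecreasing_is_cvgn => [i j|]; first exact: c_series_mono.
exists (series (c_terms R) 0 + 2 * c_terms R 0) => _ [k _ <-].
exact: c_series_tail.
Qed.

Lemma c_const_ge (n : nat) : series (c_terms R) n <= c_const R.
Proof.
by apply: nondecreasing_cvgn_le c_series_cvg n => i j; exact: c_series_mono.
Qed.

Lemma c_const_le (n : nat) :
  c_const R <= series (c_terms R) n + 2 * c_terms R n.
Proof.
apply: limr_le; first exact: c_series_cvg.
by near=> k; exact: c_series_tail.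
Unshelve. all: by end_near.
Qed.

Lemma c_const_bounds : 14 / 10 + 39 / 10 ^+ 4 <= c_const R < 14 / 10 + 40 / 10 ^+ 4.
Proof.
have xS i : 2 ^+ (2 ^ i.+1)%N = (2 ^+ (2 ^ i)%N) ^+ 2 :> R.
  by rewrite expnS mulnC exprM.
have x0 : 2 ^+ (2 ^ 0)%N = 2 :> R by [].
have x1 : 2 ^+ (2 ^ 1)%N = 4 :> R by rewrite xS x0; ring.
have x2 : 2 ^+ (2 ^ 2)%N = 16 :> R by rewrite xS x1; ring.
have x3 : 2 ^+ (2 ^ 3)%N = 256 :> R by rewrite xS x2; ring.
have S4 : series (c_terms R) 4 = 1 + 1 / 3 + 1 / 15 + 1 / 255.
  rewrite /series /= 4?big_nat_recr // big_geq //= /c_terms x0 x1 x2 x3.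
  have -> : 2 - 1 = 1 :> R by lra.
  have -> : 4 - 1 = 3 :> R by lra.
  have -> : 16 - 1 = 15 :> R by lra.
  have -> : 256 - 1 = 255 :> R by lra.
  by lra.
(* The four terms sum to 1.40392..., and adding 2 / 25600 still stays below 1.404. *)
have c4 : c_terms R 4 <= 256^-1 * 100^-1.
  by rewrite /c_terms xS x3 expr2 -invfM lef_pV2 ?posrE; nra.
have := c_const_ge 4; have := c_const_le 4; rewrite S4 => H1 H2.
by apply/andP; split; lra.
Qed.

Lemma weight_le_c (N : nat) : (0 < N)%N -> W [:: N] <= c_const R * (N%:R - 1).
Proof.
move=> N0; rewrite /total_weight big_seq1 /weight -subn1 natrB //.
by rewrite ler_wpM2r ?subr_ge0 ?ler1n // c_const_ge.
Qed.

Fixpoint tower_height (m : nat) : nat :=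
  if m is m'.+1 then (1 + (2 ^ (2 ^ m') + 1) * tower_height m')%N else 1%N.

(** With S the partial sum and q = 2^(2^m), 1 + (q + 1) S (q - 1) = 1 + S (q^2 - 1), and the 1 is
    the next term 1 / (q^2 - 1) times q^2 - 1. *)
Lemma tower_heightE (m : nat) :
  (tower_height m)%:R = series (c_terms R) m.+1 * ((2 ^ (2 ^ m))%N%:R - 1).
Proof.
elim: m => [|m IH].
  by rewrite /series /= big_nat1 /c_terms expn0 expr1 expn1 mulVf.
have -> : tower_height m.+1 = (1 + (2 ^ (2 ^ m) + 1) * tower_height m)%N by [].
rewrite natrD natrM IH natrD /series /= [in RHS]big_nat_recr //=.
rewrite !natrX /c_terms [in RHS]expnS [in RHS]mulnC exprM.
set x := 2 ^+ (2 ^ m)%N.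
have x2 : 2 <= x :> R by rewrite /x -[leLHS]expr1 ler_weXn2l ?ler1n // expn_gt0.
have n0 : x ^+ 2 - 1 != 0 by rewrite lt0r_neq0 //; nra.
by rewrite [RHS]mulrDl mulVf // addrC; congr (_ + _); ring.
Qed.

Lemma tower_height_floor (m : nat) :
  Num.floor (c_const R * ((2 ^ (2 ^ m))%N%:R - 1)) = (tower_height m)%:Z.
Proof.
set q : R := _%:R.
have q2 : 2 <= q.
  by rewrite /q natrX -[leLHS]expr1 ler_weXn2l ?ler1n // expn_gt0.
apply: floor_def; rewrite -!natz intrD !mulrz_nat tower_heightE -/q.
have := c_const_ge m.+1; have := c_const_le m.+1.
have : c_terms R m.+1 * (q - 1) = (q + 1)^-1.
  rewrite /c_terms expnS mulnC exprM -natrX -/q.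
  have -> : q ^+ 2 - 1 = (q - 1) * (q + 1) by ring.
  by rewrite invfM mulrAC mulVf ?mul1r // lt0r_neq0 //; lra.
(* The tail is at most 2 / (q^2 - 1); times q - 1 this is 2 / (q + 1) <= 2 / 3 < 1. *)
have : (q + 1)^-1 <= 3^-1 by rewrite lef_pV2 ?posrE; lra.
move: (series _ _) (c_terms _ _) (c_const _) => S d c h1 h2 h3 h4.
apply/andP; split; first by rewrite ler_wpM2r //; lra.
have : c * (q - 1) <= (S + 2 * d) * (q - 1) by rewrite ler_wpM2r //; lra.
by lra.
Qed.

(** * Long chains *)

(** Strictness is recorded as a drop of weight: weights are additive, so the condition survives the
    addition of other columns. *)
Inductive level_chain : nat -> seq nat -> seq nat -> Prop :=
  | level_chain0 (l : seq nat) : level_chain 0 l l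
  | level_chainS (n : nat) (l k l' : seq nat) :
      level_step l k -> W k + 1 <= W l -> level_chain n k l' ->
      level_chain n.+1 l l'.

Lemma level_chain_trans (n n' : nat) (l k l' : seq nat) :
  level_chain n l k -> level_chain n' k l' -> level_chain (n + n') l l'.
Proof.
by elim=> // {}n {}l k1 {}k st w _ IH /IH; apply: level_chainS.
Qed.

Lemma level_chain_context (n : nat) (p l l' r : seq nat) :
  level_chain n l l' -> level_chain n (p ++ l ++ r) (p ++ l' ++ r).
Proof.
elim=> [{}l|{}n {}l k {}l' st w _ IH]; first exact: level_chain0.
apply: level_chainS IH; last by rewrite !total_weight_cat; lra.
case: st => l1 s l2 t s0 oat; rewrite -!catA /= !(catA p).
exact: LevelStep.
Qed.

Lemma level_chain_cat (n n' : nat) (l l' k k' : seq nat) :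
  level_chain n l l' -> level_chain n' k k' ->
  level_chain (n + n') (l ++ k) (l' ++ k').
Proof.
move=> ll' kk'; apply: (@level_chain_trans _ _ _ (l' ++ k)).
  exact: (level_chain_context [::] k ll').
by have := level_chain_context l' [::] kk'; rewrite !cats0.
Qed.

Lemma level_chain_chain (N n : nat) (l l' : seq nat) : (0 < N)%N ->
  oa_levels N l -> level_chain n l l' -> normal_levels l' = [:: 1%N] ->
  chain N (normal_levels l) n.
Proof.
move=> N0 oal ll' El'; elim: ll' El' oal => [k ->|{}n {}l k {}l' st w _ IH El' oal].
  by move=> _; exact: chain0.
apply: (chainS (P := normal_levels k)).
- by case: oal => A [OA <-]; exists A.
- by apply/(dominatedP _ _ N0); exists l, k; split=> //; exact: rt_step.
- by move=> E; move: w; rewrite -total_weight_normal E total_weight_normal; lra.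
- exact: IH El' (oa_levels_step oal st).
Qed.

End Weight.

(** * Existence of the height *)

Lemma is_height_exists (R : realType) (N : nat) : 0 < N ->
  exists2 h, is_height N [:: N] h & forall n, chain N [:: N] n -> n <= h.
Proof.
move=> N0.
have bound n : `[< chain N [:: N] n >] -> n <= Num.trunc (total_weight R [:: N]).
  move=> /asboolP /(chain_weight R N0) H.
  by rewrite truncn_ge_nat //; exact: le_trans (ler0n _ _) H.
(* For N > 1, replacing the factor by the trivial array gives a chain of length 1. *)
have ex : exists n, `[< chain N [:: N] n >].
  have [->|N1] := eqVneq N 1; first by exists 0; apply/asboolP/chain0.
  exists 1; apply/asboolP.
  have E : normal_levels [:: N] = [:: N] by rewrite /normal_levels /= ifT //; lia.
  apply: (chainS (P := [:: 1])); last exact: chain0.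
  - have [A [OA EA]] := oa_levels_full N.
    by exists A; split=> //; rewrite -[RHS]E -EA.
  - apply/(dominatedP _ _ N0); exists [:: N], [:: 1].
    split=> //; first exact: oa_levels_full.
    by apply: rt_step; exact: (LevelStep [::] [::] N0 (oa_levels_trivial N)).
  - by case=> E1; rewrite -E1 in N1.
case: (ex_maxnP ex bound) => h /asboolP hc hmax; exists h.
  split; last by move=> n /down_path_chain c; apply: hmax; exact/asboolP.
  by apply: max_chain_down_path => // k c; apply: hmax; exact/asboolP.
by move=> n c; apply: hmax; exact/asboolP.
Qed.

(** A longest path exists, so the default value of [xget] is not taken. *)
Lemma ht_is_height (R : realType) (N : nat) : 0 < N -> is_height N [:: N] (ht N).
Proof.
by move=> /(is_height_exists R)[h hh _]; apply: xgetPex; exists h.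
Qed.

Lemma chain_le_ht (R : realType) (N n : nat) :
  0 < N -> chain N [:: N] n -> n <= ht N.
Proof.
move=> N0; have [h [hp _] hmax] := is_height_exists R N0.
have [_ htmax] := ht_is_height R N0.
by move=> /hmax nh; exact: leq_trans nh (htmax _ hp).
Qed.

(** * Affine planes *)

Definition factor_of (T U : finType) (g : T -> U) : factor #|T| :=
  Factor (fun r : 'I_#|T| => enum_rank (g (enum_val r))).

Lemma factor_of_balanced (T U : finType) (g : T -> U) :
  uniform g -> balanced (factor_of g).
Proof.
move=> ug; apply/balancedP.
apply: (uniform_comp (F := g \o enum_val) (G := @enum_rank U)).
  by apply: uniform_comp ug; apply/uniform_bij/enum_val_bij.
exact/uniform_bij/enum_rank_bij.
Qed.

Lemma factor_of_orthogonal (T U V : finType) (g : T -> U) (h : T -> V) :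
  bijective (fun r => (g r, h r)) -> orthogonal (factor_of g) (factor_of h).
Proof.
move=> gh; apply/orthogonalP.
apply: (uniform_comp (F := (fun r => (g r, h r)) \o enum_val)
  (G := fun p => (enum_rank p.1, enum_rank p.2))).
  apply: uniform_comp; last exact: uniform_bij.
  exact/uniform_bij/enum_val_bij.
apply: uniform_bij; exists (fun p => (enum_val p.1, enum_val p.2)) => -[a b] /=.
  by rewrite !enum_rankK.
by rewrite !enum_valK.
Qed.

Lemma uniform_snd (T U : finType) : uniform (@snd T U).
Proof.
suff H z : #|[pred p : T * U | p.2 == z]| = #|T| by move=> x y; rewrite !H.
have inj : injective (fun r : T => (r, z)) by move=> a b [].
rewrite -(fintype.card_image inj); apply: eq_card => -[a b]; rewrite !inE /=.
by apply/eqP/fintype.imageP => [->|[r _ [_ ->]] //]; exists a.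
Qed.

(** Rows are the points of the affine plane, columns its parallel classes: lines from different
    classes meet in exactly one point. *)
Lemma oa_levels_affine (F : finFieldType) :
  oa_levels (#|F| * #|F|) (nseq (#|F| + 1) #|F|).
Proof.
rewrite -card_prod.
(* The fibres of [line a] are the lines of slope -a; the first coordinate supplies the vertical
   class. *)
pose line (a : F) (p : F * F) := (a * p.1 + p.2)%R.
have bij1 a : bijective (fun p : F * F => (p.1, line a p)).
  apply: inj_card_bij => // -[x y] [x' y'] [/= -> ].
  by rewrite /line /= => /addrI ->.
have bij2 a b : a != b -> bijective (fun p : F * F => (line a p, line b p)).
  move=> ab; apply: inj_card_bij; last by [].
  move=> [x y] [x' y']; rewrite /line /= => -[E1 E2].
  have Ex : x = x'.
    apply: (@mulfI _ (a - b)%R); first by rewrite subr_eq0.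
    have -> : ((a - b) * x = (a * x + y) - (b * x + y))%R by ring.
    by rewrite E1 E2; ring.
  by move: E1; rewrite Ex => /addrI ->.
have ulin a : uniform (line a).
  exact: (uniform_comp (uniform_bij (bij1 a)) (@uniform_snd F F)).
have ufst : uniform (@fst F F).
  apply: (uniform_comp (F := fun p : F * F => (p.2, p.1)) (G := snd)).
    by apply: uniform_bij; exists (fun p => (p.2, p.1)) => -[].
  exact: uniform_snd.
exists (factor_of (@fst F F) :: [seq factor_of (line a) | a <- enum F]); split.
  split=> //=.
  - rewrite factor_of_balanced //= all_map; apply/allP => a _ /=.
    exact: factor_of_balanced.
  - rewrite all_map pairwise_map; apply/andP; split.
      by apply/allP => a _ /=; exact: factor_of_orthogonal.
    have := enum_uniq F; rewrite uniq_pairwise; apply: sub_pairwise => a b ab /=.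
    exact/factor_of_orthogonal/bij2.
rewrite addn1 /= -map_comp; congr cons; rewrite [X in nseq X _]cardE.
by elim: (enum F) => //= a s ->.
Qed.

Lemma tower_chain (R : realType) (m : nat) :
  exists2 l, level_chain R (tower_height m) [:: 2 ^ (2 ^ m)] l & all (eq_op^~ 1) l.
Proof.
(* Since s does not occur in t, the alternative of an unchanged parameter set is excluded and the
   weight drops. *)
have step_chain s t n l : 1 < s -> oa_levels s t -> s \notin t ->
    level_chain R n t l -> level_chain R n.+1 [:: s] l.
  move=> s1 oat st tl; apply: level_chainS tl.
    by have := LevelStep [::] [::] (ltnW s1) oat; rewrite /= cats0.
  have [E|] := oa_levels_weight R s1 oat; last by rewrite /total_weight big_seq1.
  by have := mem_head s [::]; rewrite -E mem_filter (negbTE st) andbF.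
elim: m => [|m [l chl l1]].
  exists [:: 1] => //; apply: step_chain (level_chain0 _ _) => //.
  exact: oa_levels_trivial.
set q := 2 ^ (2 ^ m) in chl *.
have q1 : 1 < q by rewrite -[1](expn0 2) ltn_exp2l // expn_gt0.
have Eq : 2 ^ (2 ^ m.+1) = q * q by rewrite expnS mul2n -addnn expnD.
(* The n factors with q levels are exhausted one after the other. *)
have chn n : exists2 k, level_chain R (n * tower_height m) (nseq n q) k &
    all (eq_op^~ 1) k.
  elim: n => [|n [k chk k1]]; first by exists [::] => //; exact: level_chain0.
  exists (l ++ k); last by rewrite all_cat l1.
  by rewrite mulSn; exact: (level_chain_cat chl chk).
have [k chk k1] := chn (q + 1); exists k => //.
rewrite Eq /= add1n; apply: step_chain chk.
- by rewrite (leq_trans q1) // leq_pmulr // ltnW.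
- have [F _ cF] := PrimePowerField (isT : prime 2) (expn_gt0 2 m : 0 < 2 ^ m).
  by have := oa_levels_affine F; rewrite cF.
- by rewrite mem_nseq negb_and neq_ltn ltn_Pmull ?orbT // ltnW.
Qed.

Local Open Scope ring_scope.

Theorem theorem1 (R : realType) :
  (* the series defining c converges, and c = 1.4039... *)
  (cvgn (series (@c_terms R)) /\
   14 / 10 + 39 / 10 ^+ 4 <= c_const R < 14 / 10 + 40 / 10 ^+ 4) /\
  (* ht(N) is well defined: a longest path exists *)
  (forall N : nat, (0 < N)%N -> is_height N [:: N] (ht N)) /\
  (forall N : nat, (0 < N)%N ->
     (ht N)%:Z <= Num.floor (c_const R * (N%:R - 1))) /\
  (forall N m : nat, N = (2 ^ (2 ^ m))%N ->
     (ht N)%:Z = Num.floor (c_const R * (N%:R - 1))).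
Proof.
have upper N : (0 < N)%N -> (ht N)%:Z <= Num.floor (c_const R * (N%:R - 1)).
  move=> N0; have [/down_path_chain /(chain_weight R N0) H _] := ht_is_height R N0.
  by rewrite floor_ge_int; apply: le_trans H (weight_le_c R N0).
split; first by split; [exact: c_series_cvg | exact: c_const_bounds].
split; first by move=> N; exact: ht_is_height.
split=> // N m EN; have N0 : (0 < N)%N by rewrite EN expn_gt0.
(* The floor equals [tower_height m], so the chain of that length gives the missing inequality. *)
apply/eqP; rewrite eq_le upper //= [in leLHS]EN tower_height_floor lez_nat.
apply: (chain_le_ht R N0); have [l chl l1] := tower_chain R m.
have El : normal_levels l = [:: 1%N].
  suff E : [seq s <- l | (1 < s)%N] = [::] by rewrite /normal_levels E.
  apply/eqP; rewrite -[_ == _]negbK -has_filter; apply/hasPn => s /(allP l1).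
  by move=> /eqP ->.
move: chl; rewrite -EN => chl.
have := level_chain_chain N0 (oa_levels_full N) chl El.
rewrite /normal_levels /= ifT // EN -[1%N](expn0 2) ltn_exp2l // expn_gt0 //.
Qed.
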